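(* Let $m,n,h,k$ be non-negative integers with $m\geq h>1$ and $n\geq k>1$. Non-decreasing sequences $A=[a_1,\dots,a_m]$ and $B=[b_1,\dots,b_n]$ of non-negative integers are the losing score lists of some $[h\text{-}k]$-bipartite hypertournament (with $|U|=m$, $|V|=n$) if and only if for all integers $p,q$ with $1\le p\le m$ and $1\le q\le n$, $$\sum_{i=1}^{p}a_i+\sum_{j=1}^{q}b_j\;\geq\;\binom{p}{h}\binom{q}{k},$$ with equality when $p=m$ and $q=n$.
   Context: An $[h\text{-}k]$-bipartite hypertournament on vertex sets $U$ and $V$ (disjoint, $|U|=m$, $|V|=n$, $m\ge h>1$, $n\ge k>1$) consists of $U$, $V$ and a set of arcs, each arc being an ordered $(h+k)$-tuple of distinct vertices with exactly $h$ entries from $U$ and exactly $k$ entries from $V$, such that for every $h$-subset $U_1\subseteq U$ and every $k$-subset $V_1\subseteq V$, the arc set contains exactly one of the $(h+k)!$ orderings of $U_1\cup V_1$. The losing score of a vertex $w$ is the number of arcs containing $w$ in which $w$ is the last entry. The losing score lists of the hypertournament are the pair of sequences obtained by listing the losing scores of the vertices of $U$, respectively of $V$, in non-decreasing order. Convention: $\binom{p}{q}=\frac{p!}{q!(p-q)!}$ if $p\ge q$ and $\binom{p}{q}=0$ if $p<q$. *)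

(* Defs.v *)
From mathcomp Require Import all_boot.

Set Implicit Arguments.
Unset Strict Implicit.
Unset Printing Implicit Defensive.

Section BipartiteHypertournament.

(* The disjoint vertex sets are the two summands of U + V. *)
Variables (U V : finType) (h k : nat).

Definition in_left (x : U + V) : bool := if x is inl _ then true else false.
Definition in_right (x : U + V) : bool := if x is inr _ then true else false.

Definition is_arc (t : (h + k).-tuple (U + V)) : bool :=
  [&& uniq t, count in_left t == h & count in_right t == k].

(* A duplicate-free tuple is an ordering of U1 :|: V1 exactly when its set of
   entries is that union. *)
Record hypertournament := Hypertournament {
  arcs : {set (h + k).-tuple (U + V)};
  arcs_are_arcs : forall t, t \in arcs -> is_arc t;
  arcs_unique_ordering : forall (U1 : {set U}) (V1 : {set V}),
    #|U1| = h -> #|V1| = k ->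
    #|[set t in arcs | [set x in t] == (inl @: U1) :|: (inr @: V1)]| = 1
}.

(* [last w t] is the last entry of t, the default w being used only when t is
   empty. *)
Definition losing_score (H : hypertournament) (w : U + V) : nat :=
  #|[set t in arcs H | (w \in t) && (last w t == w)]|.

Definition losing_list_left (H : hypertournament) : seq nat :=
  sort leq [seq losing_score H (inl u) | u <- enum U].

Definition losing_list_right (H : hypertournament) : seq nat :=
  sort leq [seq losing_score H (inr v) | v <- enum V].

End BipartiteHypertournament.

(* Main.v *)
Require Import Defs.
From mathcomp Require Import all_boot.

(* A hypertournament amounts to choosing, for each pair (U1, V1) of an h-subset
   and a k-subset, the last entry of the corresponding arc in U1 :|: V1.
   Prescribed scores s are therefore realizable iff the total is the number of
   pairs and every vertex set X satisfies
   s(X) >= #{(U1, V1) | U1 :|: V1 \subset X}: this is Hall's theorem in the form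
   proved by Rado, where the sets U1 :|: V1 are shrunk one element at a time to
   singletons.  Since the number of pairs inside X depends only on #|X :&: U|
   and #|X :&: V|, it is enough to require the inequality for the p smallest
   scores in U and the q smallest in V. *)

(** * Rado's theorem with prescribed multiplicities *)

Section SystemOfLosers.

Set Implicit Arguments.
Unset Strict Implicit.

Variables (E W : finType) (D : {set E}) (s : W -> nat).

Definition inside (S : E -> {set W}) (X : {set W}) : {set E} :=
  [set e in D | S e \subset X].

Local Notation shrink S e x := (fun e' => if e' == e then S e :\ x else S e').

(* [x] can be removed from [S e] unless some tight set [X] contains
   [S e :\ x] but not [x]. *)
Lemma shrink_obstruction (S : E -> {set W}) e x :
    (forall X, #|inside S X| <= \sum_(w in X) s w) -> e \in D -> x \in S e ->
    ~~ [forall X : {set W},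
          #|inside (shrink S e x) X| <= \sum_(w in X) s w] ->
  exists X : {set W}, [/\ S e :\ x \subset X, x \notin X &
    #|inside S X| = \sum_(w in X) s w].
Proof.
move=> hS eD xS /forallPn[X]; rewrite -ltnNge => ltX.
have sub: inside (shrink S e x) X \subset e |: inside S X.
  apply/subsetP=> e'; rewrite !inE.
  by case: (e' == e) => //= /andP[_ ->].
have not_sub: ~~ (inside (shrink S e x) X \subset inside S X).
  by apply/negP=> /subset_leq_card; rewrite leqNgt (leq_ltn_trans (hS X)).
have [Sx|nSx] := boolP (S e :\ x \subset X); last first.
  case/negP: not_sub; apply/subsetP=> e'; rewrite !inE; case: eqP => [->|] //.
  by rewrite (negbTE nSx) andbF.
have [xX|xX] := boolP (x \in X).
  case/negP: not_sub; apply/subsetP=> e'; rewrite !inE.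
  case: eqP => [->|] // /andP[-> _] /=.
  by rewrite -(setD1K xS) subUset sub1set xX.
(* Shrinking adds at most [e] to the members inside [X], so a bound violated afterwards was attained
   with equality before. *)
exists X; split=> //; apply/eqP; rewrite eqn_leq hS /=.
rewrite -ltnS (leq_trans ltX) // (leq_trans (subset_leq_card sub)) //.
by rewrite cardsU1; case: (_ \notin _).
Qed.

(** Members inside [X] or inside [Y] lie inside the union, and members inside both are those inside
    the intersection. The inequality is strict because [e] is inside the union only. *)
Lemma inside_supermodular (S : E -> {set W}) e (X Y : {set W}) :
    e \in D -> ~~ (S e \subset X) -> ~~ (S e \subset Y) ->
    S e \subset X :|: Y ->
  #|inside S X| + #|inside S Y| < #|inside S (X :|: Y)| + #|inside S (X :&: Y)|.
Proof.
move=> eD nX nY eXY.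
have -> : inside S (X :&: Y) = inside S X :&: inside S Y.
  by apply/setP=> f; rewrite !inE subsetI; case: (f \in D).
rewrite -cardsUI ltn_add2r; apply/proper_card/properP; split.
  apply/subsetP=> f; rewrite !inE => /orP[] /andP[-> /subset_trans->] //.
    exact: subsetUl.
  exact: subsetUr.
by exists e; rewrite !inE eD ?(negbTE nX) ?(negbTE nY).
Qed.

(** If neither of two elements [x], [y] of [S e] can be removed, there are tight sets [X] and [Y]
    avoiding [x] and [y] respectively, whose union contains [S e]. Since sums of [s] are modular,
    strict supermodularity then breaks the bound at the union or at the intersection. *)
Lemma exists_shrink (S : E -> {set W}) :
    (forall X, #|inside S X| <= \sum_(w in X) s w) ->
    (exists e, (e \in D) && (1 < #|S e|)) ->
  exists e x, [/\ e \in D, x \in S e &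
    forall X : {set W}, #|inside (shrink S e x) X| <= \sum_(w in X) s w].
Proof.
move=> hS [e /andP[eD /card_gt1P[x [y [xS yS xy]]]]].
set P := fun z => [forall X : {set W},
   #|inside (shrink S e z) X| <= \sum_(w in X) s w].
have [/forallP hx|nx] := boolP (P x); first by exists e, x.
have [/forallP hy|ny] := boolP (P y); first by exists e, y.
have [X [sX xX tX]] := shrink_obstruction hS eD xS nx.
have [Y [sY yY tY]] := shrink_obstruction hS eD yS ny.
have nX : ~~ (S e \subset X) by apply: contra xX => /subsetP->.
have nY : ~~ (S e \subset Y) by apply: contra yY => /subsetP->.
have sXY : S e \subset X :|: Y.
  apply/subsetP=> z zS; rewrite inE.
  have [zx|zx] := eqVneq z x.
    by rewrite (subsetP sY) ?orbT // !inE zS zx xy.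
  by rewrite (subsetP sX) // !inE zx zS.
have := inside_supermodular eD nX nY sXY.
have sumUI : \sum_(w in X) s w + \sum_(w in Y) s w =
             \sum_(w in X :|: Y) s w + \sum_(w in X :&: Y) s w.
  rewrite [in RHS](big_setID X) /= setUK setDUl setDv set0U -addnA.
  by congr addn; rewrite [LHS](big_setID X) /= setIC addnC.
by rewrite tX tY sumUI ltnNge leq_add.
Qed.

(** Induction on the total size of the sets [S e], shrinking until all are singletons; the choice is
    then forced. *)
Lemma system_of_losers (w0 : W) (S : E -> {set W}) :
    \sum_w s w = #|D| ->
    (forall X : {set W}, #|inside S X| <= \sum_(w in X) s w) ->
  exists f : E -> W, (forall e, e \in D -> f e \in S e) /\
    (forall w, #|[set e in D | f e == w]| = s w).
Proof.
move=> sumD; have [N] := ubnP (\sum_(e in D) #|S e|).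
elim: N S => // N IHN S ltN hS.
have [/existsP big|/existsPn small] :=
  boolP [exists e, (e \in D) && (1 < #|S e|)].
  have [e [x [eD xS hS']]] := exists_shrink hS big.
  have [|f [fS fs]] := IHN _ _ hS'.
    rewrite -ltnS (leq_trans _ ltN) // ltnS (bigD1 e) //=.
    rewrite [in leqRHS](bigD1 e) //=.
    rewrite eqxx (cardsD1 x (S e)) xS -addnA ltnS leq_add2l.
    by apply/eq_leq/eq_bigr => e' /andP[_ /negbTE->].
  exists f; split=> // e' e'D; have := fS e' e'D.
  by case: eqP => // -> /setD1P[].
have single e : e \in D -> exists x, S e = [set x].
  move=> eD; apply/cards1P; have := small e; rewrite eD /= -leqNgt => le1.
  (* An empty [S e] would lie inside the empty set, where the bound is 0. *)
  rewrite eqn_leq le1 card_gt0; apply: contraTneq (hS set0) => S0.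
  rewrite big_set0 -ltnNge; apply/card_gt0P; exists e.
  by rewrite inE eD S0 sub0set.
pose f e := odflt w0 [pick x in S e].
have fE e : e \in D -> S e = [set f e].
  rewrite /f => /single[x ->]; case: pickP => [y /set1P->//|/(_ x)].
  by rewrite inE eqxx.
exists f; split=> [e /fE->|w]; first exact: set11.
(* The bound at singletons limits each multiplicity by [s]; as both families sum to the size of [D],
   all these inequalities are equalities. *)
have le w' : true -> #|[set e in D | f e == w']| <= s w'
               ?= iff (#|[set e in D | f e == w']| == s w').
  move=> _; split=> //; have := hS [set w']; rewrite big_set1.
  apply: leq_trans; apply/subset_leq_card/subsetP=> e.
  by rewrite !inE => /andP[eD /eqP<-]; rewrite eD fE /=.
have [_] := leqif_sum le; rewrite sumD -sum1_card.
rewrite (partition_big f predT) //= (eq_bigr _ (fun w _ => sum1dep_card _)).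
by rewrite eqxx => /esym/forallP/(_ w)/eqP.
Qed.

End SystemOfLosers.

(** * Pairs of an [h]-subset and a [k]-subset as vertex sets of arcs *)

Section Blocks.

Set Implicit Arguments.
Unset Strict Implicit.

Variables (U V : finType) (h k : nat).
Implicit Types (e : {set U} * {set V}) (X : {set U + V}).

Definition vertices e : {set U + V} := inl @: e.1 :|: inr @: e.2.

(** Inverse to [vertices]: subsets of the sum type and pairs of subsets are used interchangeably. *)
Definition sides X : {set U} * {set V} := (inl @^-1: X, inr @^-1: X).

Definition blocks : {set {set U} * {set V}} :=
  [set e : {set U} * {set V} | (#|e.1| == h) && (#|e.2| == k)].

Lemma in_vertices e w :
  (w \in vertices e) = match w with inl u => u \in e.1 | inr v => v \in e.2 end.
Proof.
rewrite inE; case: w => x.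
  rewrite mem_imset ?orbF; last by move=> ? ? [].
  by case: imsetP => [[]|]; rewrite ?orbF.
rewrite orbC mem_imset; last by move=> ? ? [].
by case: imsetP => [[]|]; rewrite ?orbF.
Qed.

Lemma verticesK : cancel vertices sides.
Proof.
by case=> P Q; congr pair; apply/setP=> x; rewrite inE in_vertices.
Qed.

Lemma sidesK : cancel sides vertices.
Proof. by move=> X; apply/setP=> -[] x; rewrite in_vertices inE. Qed.

Lemma vertices_subset e X :
  (vertices e \subset X) = (e.1 \subset (sides X).1) && (e.2 \subset (sides X).2).
Proof.
by rewrite subUset; congr andb; apply/subsetP/subsetP=> sub x;
  [rewrite inE => xe; apply/sub/imset_f|case/imsetP=> y /sub + ->; rewrite inE|
   rewrite inE => xe; apply/sub/imset_f|case/imsetP=> y /sub + ->; rewrite inE].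
Qed.

Lemma card_vertices e : #|vertices e| = #|e.1| + #|e.2|.
Proof.
rewrite cardsU !card_imset; [|by move=> ? ? []|by move=> ? ? []].
rewrite (_ : _ :&: _ = set0) ?cards0 ?subn0 //; apply/setP=> w; rewrite !inE.
by apply/andP=> -[/imsetP[u _ ->] /imsetP[]].
Qed.

Lemma card_blocks_inside X :
  #|inside blocks vertices X| = 'C(#|(sides X).1|, h) * 'C(#|(sides X).2|, k).
Proof.
rewrite -!cards_draws -cardsX; apply: eq_card => e.
by rewrite !inE vertices_subset andbC andbACA.
Qed.

Lemma sides_setT : sides setT = (setT, setT).
Proof. by rewrite /sides !preimsetT. Qed.

Lemma card_blocks : #|blocks| = 'C(#|U|, h) * 'C(#|V|, k).
Proof.
transitivity #|inside blocks vertices setT|.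
  by apply: eq_card => e; rewrite [RHS]inE subsetT andbT.
by rewrite card_blocks_inside sides_setT !cardsT.
Qed.

Lemma big_sides (F : U + V -> nat) X :
  \sum_(w in X) F w =
    \sum_(u in (sides X).1) F (inl u) + \sum_(v in (sides X).2) F (inr v).
Proof.
by rewrite big_sumType; congr addn; apply: eq_bigl => x; rewrite inE.
Qed.

Lemma count_left (t : seq (U + V)) : uniq t ->
  count (@in_left U V) t = #|(sides [set w in t]).1|.
Proof.
move=> t_uniq; rewrite -size_filter -(card_uniqP (filter_uniq _ t_uniq)).
rewrite -(card_imset _ (_ : injective (@inl U V))); last by move=> ? ? [].
apply: eq_card => -[] x; rewrite mem_filter /=.
  by rewrite mem_imset ?inE // => ? ? [].
by apply/esym/imsetP => -[].
Qed.

Lemma count_right (t : seq (U + V)) : uniq t ->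
  count (@in_right U V) t = #|(sides [set w in t]).2|.
Proof.
move=> t_uniq; rewrite -size_filter -(card_uniqP (filter_uniq _ t_uniq)).
rewrite -(card_imset _ (_ : injective (@inr U V))); last by move=> ? ? [].
apply: eq_card => -[] x; rewrite mem_filter /=.
  by apply/esym/imsetP => -[].
by rewrite mem_imset ?inE // => ? ? [].
Qed.

Lemma is_arcE (t : (h + k).-tuple (U + V)) :
  is_arc t = uniq t && (sides [set w in t] \in blocks).
Proof.
rewrite /is_arc inE; have [t_uniq|//] := boolP (uniq t).
by rewrite count_left ?count_right.
Qed.

Hypothesis h_gt0 : 0 < h.

(** * Necessity: counting the arcs lost within a vertex set *)

Section Scores.

Variable H : hypertournament U V h k.

(** Sorting the arcs by their entry sets, each block inside [X] carries exactly one arc. *)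
Lemma card_arcs_inside X :
  #|[set t in arcs H | [set w in t] \subset X]| =
    'C(#|(sides X).1|, h) * 'C(#|(sides X).2|, k).
Proof.
rewrite -card_blocks_inside -[in RHS]sum1_card -sum1_card.
pose g (t : (h + k).-tuple (U + V)) := sides [set w in t].
rewrite (partition_big g (mem (inside blocks vertices X))) /=; last first.
  move=> t; rewrite !inE sidesK => /andP[/arcs_are_arcs + ->].
  by rewrite is_arcE inE andbT => /andP[].
apply: eq_bigr => e; rewrite inE => /andP[+ eX].
rewrite inE => /andP[/eqP e1 /eqP e2].
rewrite sum1dep_card -(arcs_unique_ordering H e1 e2); apply: eq_card => t.
rewrite !inE -andbA; congr andb.
rewrite -/(vertices e) /g.
apply/andP/eqP => [[_ /eqP<-]|tE]; first by rewrite sidesK.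
by rewrite tE verticesK eqxx.
Qed.

Lemma sum_losing_score X :
  \sum_(w in X) losing_score H w =
    \sum_(t in arcs H) #|[set w in X | (w \in t) && (last w t == w)]|.
Proof.
rewrite (eq_bigr (fun w => \sum_(t in arcs H)
    ((w \in t) && (last w t == w) : nat))) => [|w _]; last first.
  by rewrite /losing_score -sum1dep_card big_mkcondr.
rewrite exchange_big; apply: eq_bigr => t _.
by rewrite -sum1dep_card big_mkcondr.
Qed.

Lemma card_losers (t : seq (U + V)) X : 0 < size t -> [set w in t] \subset X ->
  #|[set w in X | (w \in t) && (last w t == w)]| = 1.
Proof.
case: t => [//|x r] _ /subsetP tX.
apply/eqP/cards1P; exists (last x r); apply/setP=> w; rewrite !inE /=.
apply/and3P/eqP => [[_ _ /eqP//]|->].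
by rewrite -in_cons mem_last tX // inE mem_last.
Qed.

Lemma arc_size_gt0 (t : (h + k).-tuple (U + V)) : 0 < size t.
Proof. by rewrite size_tuple addn_gt0 h_gt0. Qed.

(** An arc contained in [X] has its last entry there, hence contributes 1 to the sum; the other arcs
    contribute at least 0. *)
Lemma sum_losing_score_ge X :
  'C(#|(sides X).1|, h) * 'C(#|(sides X).2|, k) <= \sum_(w in X) losing_score H w.
Proof.
rewrite sum_losing_score -card_arcs_inside -sum1dep_card big_mkcondr.
by apply: leq_sum => t _; case: ifP => // /(card_losers (arc_size_gt0 t))->.
Qed.

Lemma sum_all_losing_scores :
  \sum_w losing_score H w = 'C(#|U|, h) * 'C(#|V|, k).
Proof.
transitivity (\sum_(w in [set: U + V]) losing_score H w).
  by apply: eq_bigl => w; rewrite inE.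
have := card_arcs_inside setT; rewrite sides_setT !cardsT => <-.
rewrite sum_losing_score -sum1dep_card; apply: eq_big => t.
  by rewrite subsetT andbT.
by move=> _; rewrite (card_losers (arc_size_gt0 t)) ?subsetT.
Qed.

End Scores.

(** * Sufficiency: a hypertournament from a choice of last vertices *)

Section Construction.

Variable f : {set U} * {set V} -> U + V.
Hypothesis fP : forall e, e \in blocks -> f e \in vertices e.

(* The default [nseq_tuple] is irrelevant: for a block [e] the sequence has size
   [h + k]. *)
Definition arc_of e : (h + k).-tuple (U + V) :=
  insubd (nseq_tuple (h + k) (f e)) (rcons (enum (vertices e :\ f e)) (f e)).

Lemma arc_ofE e : e \in blocks ->
  arc_of e = rcons (enum (vertices e :\ f e)) (f e) :> seq _.
Proof.
move=> eB; rewrite val_insubd size_rcons -cardE.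
have := cardsD1 (f e) (vertices e); rewrite fP // add1n => <-.
by move: eB; rewrite card_vertices inE => /andP[/eqP-> /eqP->]; rewrite eqxx.
Qed.

Lemma entries_arc_of e : e \in blocks -> [set w in arc_of e] = vertices e.
Proof.
move=> eB; apply/setP=> w; rewrite inE [LHS](_ : _ = (w \in tval (arc_of e))) //.
rewrite arc_ofE // mem_rcons inE mem_enum in_setD1.
by case: eqP => // ->; rewrite fP.
Qed.

Lemma arc_of_inj : {in blocks &, injective arc_of}.
Proof.
move=> e e' eB e'B ee'; apply: (can_inj verticesK).
by rewrite -!entries_arc_of // ee'.
Qed.

Lemma arc_ofP e : e \in blocks -> is_arc (arc_of e).
Proof.
move=> eB; rewrite is_arcE entries_arc_of // verticesK eB andbT.
by rewrite arc_ofE // rcons_uniq enum_uniq mem_enum setD11.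
Qed.

Lemma arc_of_arcs : forall t, t \in arc_of @: blocks -> is_arc t.
Proof. by move=> t /imsetP[e eB ->]; apply: arc_ofP. Qed.

Lemma arc_of_unique (U1 : {set U}) (V1 : {set V}) : #|U1| = h -> #|V1| = k ->
  #|[set t in arc_of @: blocks |
      [set w in t] == (inl @: U1) :|: (inr @: V1)]| = 1.
Proof.
move=> cU cV; have eB : (U1, V1) \in blocks by rewrite inE cU cV !eqxx.
apply/eqP/cards1P; exists (arc_of (U1, V1)); apply/setP=> t; rewrite !inE.
apply/andP/eqP => [[/imsetP[e e'B ->]]|->]; last first.
  by rewrite imset_f // entries_arc_of.
rewrite entries_arc_of // => /eqP.
by move/(can_inj verticesK (x1 := e) (x2 := (U1, V1)))->.
Qed.

Definition hypertournament_of : hypertournament U V h k :=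
  Hypertournament arc_of_arcs arc_of_unique.

(** Since [arc_of] is injective on blocks and puts [f e] last, arcs lost by [w] correspond to blocks
    with choice [w]. *)
Lemma losing_score_of w :
  losing_score hypertournament_of w = #|[set e in blocks | f e == w]|.
Proof.
rewrite -(card_in_imset (f := arc_of)) => [|e e']; last first.
  by move=> /setIdP[eB _] /setIdP[e'B _]; apply: arc_of_inj.
have lastE e : e \in blocks ->
    (w \in arc_of e) && (last w (arc_of e) == w) = (f e == w).
  move=> eB; rewrite [w \in _](_ : _ = (w \in tval (arc_of e))) //.
  rewrite arc_ofE // mem_rcons last_rcons in_cons [w == _]eq_sym.
  by case: eqP; rewrite ?andbF.
apply: eq_card => t; rewrite inE; apply/andP/imsetP => [[/imsetP[e eB ->]]|[e]].
  by rewrite lastE // => few; exists e; rewrite // inE eB.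
by rewrite inE => /andP[eB few] ->; rewrite imset_f // lastE.
Qed.

End Construction.

Lemma realize_losing_scores (w0 : U + V) (s : U + V -> nat) :
    \sum_w s w = 'C(#|U|, h) * 'C(#|V|, k) ->
    (forall X, 'C(#|(sides X).1|, h) * 'C(#|(sides X).2|, k)
                 <= \sum_(w in X) s w) ->
  exists H : hypertournament U V h k, losing_score H =1 s.
Proof.
rewrite -card_blocks => sumE hall.
have [|f [fP fs]] := system_of_losers w0 sumE (S := vertices).
  by move=> X; rewrite card_blocks_inside.
by exists (hypertournament_of fP) => w; rewrite losing_score_of.
Qed.

End Blocks.

(** * Initial sums of a sorted list as minimal sums over subsets *)

Section SortedSums.

Set Implicit Arguments.
Unset Strict Implicit.

Lemma sum_smallest_le m (A : m.-tuple nat) (X : {set 'I_m}) : sorted leq A ->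
  \sum_(i < m | i < #|X|) tnth A i <= \sum_(i in X) tnth A i.
Proof.
move=> hA; set p := #|X|; pose I := [set i : 'I_m | i < p].
have le_pm : p <= m by rewrite -[m in _ <= m]card_ord max_card.
have A_mono i j : i <= j -> j < m -> nth 0 A i <= nth 0 A j.
  move=> ij jm; apply: (sorted_leq_nth leq_trans leqnn) => //; rewrite inE size_tuple //.
  exact: leq_ltn_trans jm.
have cardI : #|I| = p.
  rewrite -sum1_card (eq_bigl (fun i : 'I_m => i < p)) => [|i]; last by rewrite inE.
  by rewrite -(big_ord_widen m (fun=> 1)) // sum1_card card_ord.
have cardD : #|I :\: X| = #|X :\: I|.
  by apply/eqP; rewrite -(eqn_add2l #|I :&: X|) cardsID setIC cardsID cardI.
rewrite (eq_bigl (mem I)) => [|i]; last by rewrite /= inE.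
rewrite (big_setID X) [leqRHS](big_setID I) /= setIC leq_add2l.
(* After the common part is cancelled, the entry at [p.-1] separates the two equally large
   differences: indices in [I] lie at or below it, those outside above. For [p = 0] both differences
   are empty. *)
apply: (@leq_trans (\sum_(i in I :\: X) nth 0 A p.-1)).
  apply: leq_sum => i; rewrite !inE => /andP[_ ip]; rewrite (tnth_nth 0).
  have p0 : 0 < p by apply: leq_ltn_trans ip.
  by apply: A_mono; rewrite -ltnS prednK.
rewrite sum_nat_const cardD -sum_nat_const.
apply: leq_sum => i; rewrite !inE -leqNgt => /andP[pi _]; rewrite (tnth_nth 0).
by apply: A_mono; rewrite // (leq_trans (leq_pred _)).
Qed.

Lemma sum_smallest_sort (T : finType) (F : T -> nat) m (A : m.-tuple nat) p :
    sort leq [seq F x | x <- enum T] = A -> p <= m ->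
  exists X : {set T}, #|X| = p /\
    \sum_(i < m | i < p) tnth A i = \sum_(x in X) F x.
Proof.
(* Sorting the values amounts to sorting the elements by [F], so the first [p] elements of [r] form
   the required set. *)
rewrite sort_map; set r := sort _ _ => rA le_pm.
have r_uniq : uniq r by rewrite sort_uniq enum_uniq.
have size_r : size r = m by rewrite -(size_map F) rA size_tuple.
exists [set x in take p r]; split.
  by rewrite cardsE (card_uniqP (take_uniq _ r_uniq)) size_takel ?size_r.
rewrite (eq_bigl (mem (take p r))) => [|x]; last by rewrite inE.
rewrite -big_uniq ?take_uniq //= -(big_map F predT id) map_take rA.
rewrite (eq_bigr (fun i : 'I_m => nth 0 A i)) => [|i _]; last exact: tnth_nth.
rewrite -(big_ord_widen m (nth 0 A)) // (big_nth 0) size_takel ?size_tuple //.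
by rewrite big_mkord; apply: eq_bigr => i _; rewrite nth_take.
Qed.

Lemma sort_tnth m (A : m.-tuple nat) : sorted leq A ->
  sort leq [seq tnth A i | i <- enum 'I_m] = A.
Proof. by move=> hA; rewrite map_tnth_enum (sorted_sort leq_trans). Qed.

End SortedSums.

(** * From arbitrary vertex sets to initial segments of the score lists *)

Theorem theorem2p1 (m n h k : nat) (hh : 1 < h) (hm : h <= m)
    (hk : 1 < k) (hn : k <= n)
    (A : m.-tuple nat) (B : n.-tuple nat)
    (hA : sorted leq A) (hB : sorted leq B) :
  (exists (U V : finType) (H : hypertournament U V h k),
      [/\ #|U| = m, #|V| = n,
          losing_list_left H = A & losing_list_right H = B])
  <->
  ((forall p q : nat, 1 <= p <= m -> 1 <= q <= n ->
      'C(p, h) * 'C(q, k) <=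
        \sum_(i < m | i < p) tnth A i + \sum_(j < n | j < q) tnth B j)
   /\ \sum_(i < m) tnth A i + \sum_(j < n) tnth B j = 'C(m, h) * 'C(n, k)).
Proof.
split=> [[U [V [H [cU cV HA HB]]]]|[hall total]].
  have bound p q : p <= m -> q <= n ->
      exists X : {set U + V}, [/\ #|(sides X).1| = p, #|(sides X).2| = q &
        \sum_(i < m | i < p) tnth A i + \sum_(j < n | j < q) tnth B j =
        \sum_(w in X) losing_score H w].
    move=> pm qn.
    have [P [cP ->]] := sum_smallest_sort HA pm.
    have [Q [cQ ->]] := sum_smallest_sort HB qn.
    exists (vertices (P, Q)); rewrite big_sides verticesK; split=> //.
  split=> [p q /andP[_ pm] /andP[_ qn]|].
    have [X [<- <- ->]] := bound p q pm qn.
    exact: sum_losing_score_ge (ltnW hh) H X.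
  have [X [cX1 cX2 sumX]] := bound m n (leqnn m) (leqnn n).
  have XT : X = setT.
    apply/eqP; rewrite eqEcard subsetT -[X]sidesK card_vertices cX1 cX2.
    by rewrite cardsT card_sum cU cV leqnn.
  have := sum_all_losing_scores (ltnW hh) H; rewrite cU cV => <-.
  rewrite (eq_bigl (mem X)) => [|w]; last by rewrite XT /= inE.
  rewrite -sumX; congr addn; apply: eq_bigl => i; exact/esym/ltn_ord.
(* The vertices are the list positions themselves, each with its entry as prescribed score. *)
pose s (w : 'I_m + 'I_n) := match w with inl i => tnth A i | inr j => tnth B j end.
have m_gt0 : 0 < m by apply: leq_trans hm; apply: ltnW.
have [||H Hs] := @realize_losing_scores _ _ h k (inl (Ordinal m_gt0)) s.
- by rewrite big_sumType !card_ord.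
- move=> X; rewrite big_sides.
  apply: leq_trans (leq_add (sum_smallest_le _ hA) (sum_smallest_le _ hB)).
  (* [hall] covers only positive [p] and [q]; if a side is empty, its binomial coefficient vanishes
     because [h] and [k] are positive. *)
  have [->|p_gt0] := posnP #|(sides X).1|.
    by rewrite bin_small // ltnW.
  have [->|q_gt0] := posnP #|(sides X).2|.
    by rewrite mulnC bin_small // ltnW.
  by apply: hall; rewrite ?p_gt0 ?q_gt0 /= -[leqRHS]card_ord max_card.
exists 'I_m, 'I_n, H; rewrite !card_ord; split=> //.
  by rewrite -[RHS](sort_tnth hA); congr sort; apply: eq_map => i; apply: Hs.
by rewrite -[RHS](sort_tnth hB); congr sort; apply: eq_map => j; apply: Hs.
Qed.
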